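(* Let $f,g$ be non-degenerate real ternary quadratic forms generating a pencil in orbit I or Ia. (1) If it is orbit I, then $p_2<0$ and $\Phi_{30}A_1>0$. (2) If it is orbit Ia, then $p_2>0$, or $\Phi_{30}A_1<0$, or $p_2=A_1=0$.
   Context: A pencil of conics is a projective line in $\mathbb{P}(S^2{\mathbb{R}^3}^* )$. Orbits of pencils are under $PGL(3,\mathbb{R})$: orbit I is the orbit of the pencil generated by $x^2-y^2$ and $x^2-z^2$; orbit Ia that of the pencil generated by $x^2+y^2+z^2$ and $xz$. Let $\mathrm{Matrix}(q)$ be the symmetric matrix of a quadratic form $q$, and $\phi(t)=\det\mathrm{Matrix}(tf+g)=\Phi_{30}t^3+\Phi_{21}t^2+\Phi_{12}t+\Phi_{03}$. Define $\psi(t)$ by $\det(vI-\mathrm{Matrix}(tf+g))=v^3-\mu(t)v^2+\psi(t)v-\phi(t)$. Let $P=p_2t^2+p_1t+p_0$ be the remainder in the euclidean division of $\Phi_{30}\,\psi\,\phi'$ by $\phi$, and $$A_1=\begin{vmatrix} \Phi_{30} & \Phi_{21} & \Phi_{12} \\ 0 & p_2 & p_1 \\ p_2 & p_1 & p_0 \end{vmatrix}.$$ *)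

(* Defs.v *)
From HB Require Import structures.
From mathcomp Require Import all_boot all_order all_algebra reals.
From mathcomp Require Import mpoly.

Set Implicit Arguments.
Unset Strict Implicit.
Unset Printing Implicit Defensive.

Import Order.TTheory GRing.Theory Num.Theory.
Local Open Scope ring_scope.

Notation qform R := (dhomog 3 R 2).

Section QuadraticForms.
Variable R : realType.
Implicit Types (M : 'M[R]_3) (f g q : qform R) (L : {vspace qform R}).

Definition ternary_x : 'I_3 := @Ordinal 3 0 isT.
Definition ternary_y : 'I_3 := @Ordinal 3 1 isT.
Definition ternary_z : 'I_3 := @Ordinal 3 2 isT.

Local Notation x := ('X_ternary_x : {mpoly R[3]}).
Local Notation y := ('X_ternary_y : {mpoly R[3]}).
Local Notation z := ('X_ternary_z : {mpoly R[3]}).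

Lemma mulXX_homog (i j : 'I_3) : ('X_i * 'X_j : {mpoly R[3]}) \is 2.-homog.
Proof.
by apply: (@dhomogM _ _ _ 1 _ 1 _); rewrite dhomogX /= mdeg1.
Qed.

Lemma conic_xy_homog : x ^+ 2 - y ^+ 2 \is 2.-homog.
Proof. by rewrite rpredB // expr2 mulXX_homog. Qed.

Lemma conic_xz_homog : x ^+ 2 - z ^+ 2 \is 2.-homog.
Proof. by rewrite rpredB // expr2 mulXX_homog. Qed.

Lemma conic_xyz_homog : x ^+ 2 + y ^+ 2 + z ^+ 2 \is 2.-homog.
Proof. by rewrite !rpredD // expr2 mulXX_homog. Qed.

(* A pencil, i.e. a projective line in the projective space of ternary
   quadratic forms, is identified with the corresponding 2-dimensional linear
   subspace of the space of forms. *)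
Definition is_pencil L : Prop := \dim L = 2.

Definition pencil_I : {vspace qform R} :=
  <<[:: DHomog conic_xy_homog; DHomog conic_xz_homog]>>%VS.

Definition pencil_Ia : {vspace qform R} :=
  <<[:: DHomog conic_xyz_homog; DHomog (mulXX_homog ternary_x ternary_z)]>>%VS.

Definition linear_forms M : 3.-tuple {mpoly R[3]} :=
  [tuple \sum_(j < 3) M i j *: 'X_j | i < 3].

Lemma qsubst_homog M q : (q : {mpoly R[3]}) \mPo linear_forms M \is 2.-homog.
Proof.
rewrite comp_mpolyE big_seq; apply: rpred_sum => m hm; apply: rpredZ.
have h1 i : tnth (linear_forms M) i \is 1.-homog.
  rewrite tnth_mktuple; apply: rpred_sum => j _; apply: rpredZ.
  by rewrite dhomogX /= mdeg1.
suff : \prod_(i < 3) tnth (linear_forms M) i ^+ m i \is (mdeg m).-homog.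
  by rewrite (dhomog_mf (valP q) hm).
rewrite mdegE; elim/big_rec2: _ => [|i d p _ hp]; first exact: dhomog1.
by apply: dhomogM => //; rewrite -[X in X.-homog]mul1n; apply: dhomogMn.
Qed.

(* The form q(M v). *)
Definition qsubst M q : qform R := DHomog (qsubst_homog M q).

Lemma qsubst_is_linear M : linear (qsubst M).
Proof. by move=> a p q; apply: val_inj; rewrite /= linearP. Qed.

HB.instance Definition _ M :=
  GRing.isLinear.Build R (qform R) (qform R) _ (qsubst M) (qsubst_is_linear M).

(* An element of PGL(3, R) is represented by an invertible matrix: scalar
   matrices fix every subspace, so GL(3, R) and PGL(3, R) have the same
   orbits on pencils. *)
Definition in_orbit L0 L : Prop :=
  exists2 M : 'M[R]_3, M \in unitmx & L = (linfun (qsubst M) @: L0)%VS.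

Definition orbit_I L : Prop := in_orbit pencil_I L.
Definition orbit_Ia L : Prop := in_orbit pencil_Ia L.

(* Stated over an arbitrary ring of coefficients because it is used both over
   R and over R[t]. *)
Definition qmatrix (S : comUnitRingType) (q : {mpoly S[3]}) : 'M[S]_3 :=
  \matrix_(i, j)
    if i == j then q@_(U_(i) + U_(i)) else q@_(U_(i) + U_(j)) / 2%:R.

Definition qnondegenerate q : Prop := \det (qmatrix q) != 0.

(* t f + g, with coefficients in R[t]; the variable t is ['X]. *)
Definition generic_form f g : {mpoly {poly R}[3]} :=
  'X *: map_mpoly polyC f + map_mpoly polyC g.

Definition phi f g : {poly R} := \det (qmatrix (generic_form f g)).

Definition Phi30 f g : R := (phi f g)`_3.
Definition Phi21 f g : R := (phi f g)`_2.
Definition Phi12 f g : R := (phi f g)`_1.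

(* [char_poly] is det (v I - _), here a polynomial in v over R[t]. *)
Definition psi f g : {poly R} := (char_poly (qmatrix (generic_form f g)))`_1.

Definition remP f g : {poly R} :=
  (Phi30 f g *: (psi f g * (phi f g)^`())) %% phi f g.

Definition p0 f g : R := (remP f g)`_0.
Definition p1 f g : R := (remP f g)`_1.
Definition p2 f g : R := (remP f g)`_2.

Definition A1 f g : R :=
  \det (\matrix_(i < 3, j < 3)
    (nth [::] [:: [:: Phi30 f g; Phi21 f g; Phi12 f g];
                  [::         0;    p2 f g;    p1 f g];
                  [::    p2 f g;    p1 f g;    p0 f g]] i)`_j).

End QuadraticForms.

(* Main.v *)
Require Import Defs.
From mathcomp Require Import all_boot all_order all_algebra reals.
From mathcomp Require Import mpoly.
From mathcomp Require Import ring lra.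
Set Implicit Arguments.
Unset Strict Implicit.
Unset Printing Implicit Defensive.

Import Order.TTheory GRing.Theory Num.Theory.
Local Open Scope ring_scope.

(** Both orbits consist of pencils that are simultaneously diagonalizable over
the reals. In suitable linear coordinates [l_0, l_1, l_2] every conic of the
pencil is [d_0 l_0^2 + d_1 l_1^2 + d_2 l_2^2], where [d] runs over the plane
[e . d = 0]: for orbit I, [e = (1, 1, 1)]; for orbit Ia, replacing [x, z] by
[x + z, x - z] gives [e = (1, -1, 1)]. Hence [phi] has three real roots
[t_0, t_1, t_2], and they are distinct: if two of them agreed, the equation
[e . d = 0] would make the third one agree as well, and [f], [g] would be
proportional.

At the root [t_i] the conic [t_i f + g] has [d_i = 0] and, by [e . d = 0], the
remaining two coefficients satisfy [e_j d_j = - e_k d_k]. The number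
[w_i = psi(t_i)] is the sum of the principal 2-minors of
[M^T diag(d) M], which by Cauchy-Binet is [d_j d_k] times a positive sum of
squares; so [w_i] has the sign of [- e_j e_k] ([diag_forms_roots]). Geometrically,
[w_i < 0] when the degenerate conic is a pair of real lines and [w_i > 0] when
the lines are complex conjugate. For orbit I all three [w_i] are negative; for
orbit Ia [w_0] and [w_2] are positive and [w_1] is negative.

It remains to read [p2] and [A1] off the [w_i]. With [c = Phi30], the remainder
[P] interpolates [c psi phi'] at the roots, and [phi'(t_i)] is [c] times the
denominator of the Lagrange basis polynomial, so
[P = c^2 sum_i w_i prod_(j != i) (X - t_j)] ([modp_derivM_roots]). Therefore
[p2 = c^2 sum_i w_i], while [Phi30 * A1] is [c^6] times the determinant
[s m - q^2] of Hermite's quadratic form [H(u, v) = sum_i w_i (u + v t_i)^2],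
where [s], [q], [m] are the moments of order 0, 1, 2; this determinant equals
[sum_(i < j) w_i w_j (t_i - t_j)^2] ([Phi30_A1_roots]). In orbit I, [H] is
negative definite. In orbit Ia, [H] takes a positive value at
[(u, v) = (- t_1, 1)], so [s <= 0] forces the determinant to be nonpositive,
and negative when [s < 0] ([weights_mixed_sign]). *)

(** * Matrices of order three *)

Local Notation i0 := ternary_x.
Local Notation i1 := ternary_y.
Local Notation i2 := ternary_z.

Lemma big_ord3 (T : Type) (idx : T) (op : Monoid.law idx) (F : 'I_3 -> T) :
  \big[op/idx]_i F i = op (op (F i0) (F i1)) (F i2).
Proof.
rewrite !big_ord_recl big_ord0 Monoid.mulm1 Monoid.mulmA.
by congr (op (op (F _) (F _)) (F _)); apply: val_inj.
Qed.

Lemma sum_ord3 (V : nmodType) (F : 'I_3 -> V) :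
  \sum_i F i = F i0 + F i1 + F i2.
Proof. exact: big_ord3. Qed.

Lemma ord3P (P : 'I_3 -> Prop) : P i0 -> P i1 -> P i2 -> forall i, P i.
Proof.
move=> P0 P1 P2 [[|[|[|//]]] lti].
- by rewrite (_ : Ordinal lti = i0) //; apply: val_inj.
- by rewrite (_ : Ordinal lti = i1) //; apply: val_inj.
- by rewrite (_ : Ordinal lti = i2) //; apply: val_inj.
Qed.

Lemma det_mx33 (S : comNzRingType) (A : 'M[S]_3) :
  \det A = A i0 i0 * (A i1 i1 * A i2 i2 - A i1 i2 * A i2 i1)
         - A i0 i1 * (A i1 i0 * A i2 i2 - A i1 i2 * A i2 i0)
         + A i0 i2 * (A i1 i0 * A i2 i1 - A i1 i1 * A i2 i0).
Proof.
(* Indices are moved to nat, where the nested lifts compute. *)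
pose a m n := A (inord m) (inord n).
have AE i j : A i j = a i j by rewrite /a !inord_val.
rewrite (expand_det_row _ ord0) !big_ord_recl big_ord0 /cofactor.
rewrite !(expand_det_row _ ord0) !big_ord_recl !big_ord0 /cofactor.
by rewrite !det_mx11 !mxE !AE /=; ring.
Qed.

(** The second elementary symmetric function of the eigenvalues. *)
Definition minor2_sum (S : pzRingType) (A : 'M[S]_3) : S :=
    (A i0 i0 * A i1 i1 - A i0 i1 * A i1 i0)
  + (A i0 i0 * A i2 i2 - A i0 i2 * A i2 i0)
  + (A i1 i1 * A i2 i2 - A i1 i2 * A i2 i1).

Lemma char_poly3_coef1 (S : comNzRingType) (A : 'M[S]_3) :
  (char_poly A)`_1 = minor2_sum A.
Proof.
have -> : char_poly A = 'X^3 - (\tr A)%:P * 'X^2 + (minor2_sum A)%:P * 'X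
                        - (\det A)%:P.
  rewrite /char_poly !det_mx33 !mxE /mxtrace sum_ord3 /minor2_sum /=.
  by rewrite !(mulr0n, mulr1n); ring.
rewrite !(coefB, coefD, coefCM, coefXn, coefX, coefC) /=.
by rewrite !(mulr0, mulr1, add0r, subr0, oppr0).
Qed.

Definition congr_diag (S : pzRingType) (M : 'M[S]_3) (d : 'rV[S]_3) : 'M[S]_3 :=
  M^T *m diag_mx d *m M.

Lemma congr_diagE (S : comPzRingType) (M : 'M[S]_3) d i j :
  congr_diag M d i j = \sum_k d 0 k * (M k i * M k j).
Proof.
rewrite /congr_diag mxE; apply: eq_bigr => k _.
by rewrite mul_mx_diag !mxE mulrCA -!mulrA; congr (_ * _); rewrite mulrC.
Qed.

Lemma det_congr_diag (S : comNzRingType) (M : 'M[S]_3) d :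
  \det (congr_diag M d) = \det M ^+ 2 * (d 0 i0 * d 0 i1 * d 0 i2).
Proof.
by rewrite !det_mulmx det_tr det_diag big_ord3 /=; ring.
Qed.

(** Squared norm of the cross product of rows [j] and [k]. *)
Definition minors_normsq (S : pzRingType) (M : 'M[S]_3) (j k : 'I_3) : S :=
    (M j i0 * M k i1 - M j i1 * M k i0) ^+ 2
  + (M j i0 * M k i2 - M j i2 * M k i0) ^+ 2
  + (M j i1 * M k i2 - M j i2 * M k i1) ^+ 2.

(** The case of the Cauchy-Binet formula in which the 2-minors of
[M^T diag(d) M] are summed over the diagonal. *)
Lemma minor2_sum_congr_diag (S : comNzRingType) (M : 'M[S]_3) d :
  minor2_sum (congr_diag M d) =
    minors_normsq M i1 i2 * (d 0 i1 * d 0 i2)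
  + minors_normsq M i0 i2 * (d 0 i0 * d 0 i2)
  + minors_normsq M i0 i1 * (d 0 i0 * d 0 i1).
Proof.
by rewrite /minor2_sum !congr_diagE !sum_ord3 /minors_normsq /=; ring.
Qed.

Lemma sum3_sq_gt0 (R : realDomainType) (a b c u v w : R) :
  a * u + b * v + c * w != 0 -> 0 < u ^+ 2 + v ^+ 2 + w ^+ 2.
Proof.
rewrite lt_def !addr_ge0 ?sqr_ge0 // andbT; apply: contra_neq.
move/eqP; rewrite !paddr_eq0 ?addr_ge0 ?sqr_ge0 // !sqrf_eq0.
by case/andP => /andP[/eqP -> /eqP ->] /eqP ->; rewrite !mulr0 !addr0.
Qed.

(** Two rows of an invertible matrix have a nonzero cross product, because its
scalar product with the third row is, up to sign, the determinant. *)
Lemma minors_normsq_gt0 (R : realFieldType) (M : 'M[R]_3) :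
  M \in unitmx ->
  [/\ 0 < minors_normsq M i1 i2, 0 < minors_normsq M i0 i2
    & 0 < minors_normsq M i0 i1].
Proof.
rewrite unitmxE unitfE det_mx33 => nz.
split; [apply: (@sum3_sq_gt0 _ (M i0 i2) (- M i0 i1) (M i0 i0))
       |apply: (@sum3_sq_gt0 _ (- M i1 i2) (M i1 i1) (- M i1 i0))
       |apply: (@sum3_sq_gt0 _ (M i2 i2) (- M i2 i1) (M i2 i0))];
  by apply: contra nz => /eqP nz; apply/eqP; rewrite -[RHS]nz; ring.
Qed.

(** * Interpolation at the roots of a cubic *)

(** Both sides have degree less than 3, so agreement with [c q p'] at the three
roots is enough. There [p'(t_i) = c prod_(j != i) (t_i - t_j)], which cancels
the denominators of Lagrange interpolation. *)
Lemma modp_derivM_roots (F : fieldType) (c t0 t1 t2 : F) (q p : {poly F}) :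
  c != 0 -> t0 != t1 -> t0 != t2 -> t1 != t2 ->
  p = c *: (('X - t0%:P) * ('X - t1%:P) * ('X - t2%:P)) ->
  (c *: (q * p^`())) %% p =
    c ^+ 2 *: (q.[t0] *: (('X - t1%:P) * ('X - t2%:P))
             + q.[t1] *: (('X - t0%:P) * ('X - t2%:P))
             + q.[t2] *: (('X - t0%:P) * ('X - t1%:P))).
Proof.
move=> c0 t01 t02 t12 pE; set r := RHS.
have derivE : p^`() = c *: (('X - t1%:P) * ('X - t2%:P)
   + ('X - t0%:P) * ('X - t2%:P) + ('X - t0%:P) * ('X - t1%:P)).
  rewrite pE derivZ !derivM !derivXsubC; congr (_ *: _); ring.
have prodE : ('X - t0%:P) * ('X - t1%:P) * ('X - t2%:P)
           = \prod_(t <- [:: t0; t1; t2]) ('X - t%:P).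
  by rewrite !big_cons big_nil mulr1 mulrA.
have size_p : size p = 4 by rewrite pE size_scale // prodE size_prod_XsubC.
have dvd : p %| c *: (q * p^`()) - r.
  rewrite {1}pE dvdpZl // prodE; apply: uniq_roots_dvdp; last first.
    by rewrite uniq_rootsE /= !inE t12 negb_or t01 t02.
  by rewrite /= andbT; apply/and3P; split; apply/eqP;
    rewrite /r derivE !hornerE /=; ring.
have [s sE] := dvdpP _ _ dvd.
apply/esym; apply: (@modpP _ _ s); first by rewrite -sE subrK.
rewrite size_p /r; apply: (leq_ltn_trans (size_scale_leq _ _)); rewrite ltnS.
have size2 (u v w : F) : (size (w *: (('X - u%:P) * ('X - v%:P))) <= 3)%N.
  apply: (leq_trans (size_scale_leq _ _)).
  by rewrite size_Mmonic ?monicXsubC ?polyXsubC_eq0 // !size_XsubC.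
rewrite (leq_trans (size_polyD _ _)) // geq_max size2 andbT.
by rewrite (leq_trans (size_polyD _ _)) // geq_max !size2.
Qed.

(** * Diagonal forms and their matrices *)

Lemma mnm1D_eq n (i j k l : 'I_n) :
  ((U_(i) + U_(j))%MM == (U_(k) + U_(l))%MM) =
  (i == k) && (j == l) || (i == l) && (j == k).
Proof.
have inj (u v : 'I_n) : U_(u)%MM = U_(v)%MM -> u = v.
  by move/mnmP/(_ u); rewrite !mnm1E eqxx; case: eqP.
apply/eqP/orP => [E|[/andP[/eqP -> /eqP ->] //|/andP[/eqP -> /eqP ->]]]; last first.
  by rewrite addmC.
have [ik|nik] := eqVneq i k.
  by left; rewrite ik in E; move/addmI/inj: E => ->; rewrite eqxx.
right; move/mnmP/(_ i): (E).
rewrite !mnmDE !mnm1E eqxx [k == i]eq_sym (negPf nik).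
case: (eqVneq l i) => // li _ /=.
by move: E; rewrite li [RHS]addmC => /addmI/inj ->.
Qed.

Section Forms.
Variable R : realType.
Implicit Types (M : 'M[R]_3) (d : 'rV[R]_3) (f g : qform R).

Definition linform (r : 'rV[R]_3) : {mpoly R[3]} := \sum_j r 0 j *: 'X_j.

Lemma mcoeff_linform_sq (r : 'rV[R]_3) (i j : 'I_3) :
  (linform r ^+ 2)@_(U_(i) + U_(j)) =
  if i == j then r 0 i * r 0 i else (r 0 i * r 0 j) * 2%:R.
Proof.
rewrite expr2 /linform sum_ord3 !(mulrDl, mulrDr) -!(scalerAl, scalerAr).
rewrite -!mpolyXD !mcoeffD !mcoeffZ !mcoeffX !mnm1D_eq.
by elim/ord3P: i; elim/ord3P: j => /=; ring.
Qed.

Definition diag_form M d : {mpoly R[3]} :=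
  \sum_i d 0 i *: linform (row i M) ^+ 2.

Lemma qmatrix_diag_form M d : qmatrix (diag_form M d) = congr_diag M d.
Proof.
apply/matrixP => i j; rewrite congr_diagE mxE /diag_form.
case: eqP => [<-|/eqP/negPf nij].
  rewrite raddf_sum /=; apply: eq_bigr => k _.
  by rewrite mcoeffZ mcoeff_linform_sq eqxx !mxE.
rewrite raddf_sum mulr_suml /=; apply: eq_bigr => k _.
by rewrite mcoeffZ mcoeff_linform_sq nij !mxE mulrA mulfK // pnatr_eq0.
Qed.

Lemma qmatrix_generic_form f g :
  qmatrix (generic_form f g) =
  'X *: map_mx polyC (qmatrix f) + map_mx polyC (qmatrix g).
Proof.
apply/matrixP => i j; rewrite !mxE /generic_form.
have half (p : {poly R}) : p / 2%:R = 2%:R^-1 *: p.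
  by rewrite -(rmorph_nat polyC) polyCV mulrC mul_polyC.
case: eqP => _; rewrite mcoeffD mcoeffZ !mcoeff_map_mpoly //= half.
by rewrite scalerDr -!mul_polyC !rmorphM /=; ring.
Qed.

Section DiagonalPair.
Variables (M : 'M[R]_3) (a b : 'rV[R]_3) (f g : qform R).
Hypothesis (fE : qmatrix f = congr_diag M a) (gE : qmatrix g = congr_diag M b).

Let Mp : 'M[{poly R}]_3 := map_mx polyC M.
Let dp : 'rV[{poly R}]_3 := \row_i (a 0 i *: 'X + (b 0 i)%:P).

Lemma qmatrix_generic_diag : qmatrix (generic_form f g) = congr_diag Mp dp.
Proof.
rewrite qmatrix_generic_form fE gE; apply/matrixP => i j.
(* A chain of [mxE] would unfold [congr_diag] into matrix products. *)
have mapE (A : 'M[R]_3) : map_mx polyC A i j = (A i j)%:P by rewrite mxE.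
rewrite congr_diagE mxE [X in X + _]mxE !mapE !congr_diagE.
rewrite !sum_ord3 !mxE /= -!mul_polyC; ring.
Qed.

Lemma phi_diag : phi f g = (\det M ^+ 2)%:P *
  ((a 0 i0 *: 'X + (b 0 i0)%:P) * (a 0 i1 *: 'X + (b 0 i1)%:P)
   * (a 0 i2 *: 'X + (b 0 i2)%:P)).
Proof.
by rewrite /phi qmatrix_generic_diag det_congr_diag det_map_mx !mxE rmorphXn.
Qed.

Lemma horner_psi_diag t : (psi f g).[t] =
    minors_normsq M i1 i2 * ((t * a 0 i1 + b 0 i1) * (t * a 0 i2 + b 0 i2))
  + minors_normsq M i0 i2 * ((t * a 0 i0 + b 0 i0) * (t * a 0 i2 + b 0 i2))
  + minors_normsq M i0 i1 * ((t * a 0 i0 + b 0 i0) * (t * a 0 i1 + b 0 i1)).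
Proof.
rewrite /psi char_poly3_coef1 qmatrix_generic_diag minor2_sum_congr_diag.
by rewrite /minors_normsq !mxE !hornerE /=; ring.
Qed.

End DiagonalPair.

(** * The coefficients in terms of the roots *)

Section ThreeRoots.
Variables (f g : qform R) (c t0 t1 t2 : R).
Hypothesis (c0 : c != 0) (t01 : t0 != t1) (t02 : t0 != t2) (t12 : t1 != t2).
Hypothesis phiE : phi f g = c *: (('X - t0%:P) * ('X - t1%:P) * ('X - t2%:P)).

Let w0 := (psi f g).[t0].
Let w1 := (psi f g).[t1].
Let w2 := (psi f g).[t2].

Lemma coef_phi_roots :
  [/\ Phi30 f g = c, Phi21 f g = - c * (t0 + t1 + t2)
    & Phi12 f g = c * (t0 * t1 + t0 * t2 + t1 * t2)].
Proof.
have E : phi f g = c *: ('X^3 - (t0 + t1 + t2)%:P * 'X^2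
  + (t0 * t1 + t0 * t2 + t1 * t2)%:P * 'X - (t0 * t1 * t2)%:P).
  by rewrite phiE; congr (_ *: _); ring.
rewrite /Phi30 /Phi21 /Phi12 E !coefZ !(coefB, coefD, coefCM, coefXn, coefX, coefC) /=.
split; ring.
Qed.

Lemma coef_remP_roots :
  [/\ p2 f g = c ^+ 2 * (w0 + w1 + w2),
      p1 f g = - c ^+ 2 * (w0 * (t1 + t2) + w1 * (t0 + t2) + w2 * (t0 + t1))
    & p0 f g = c ^+ 2 * (w0 * (t1 * t2) + w1 * (t0 * t2) + w2 * (t0 * t1))].
Proof.
have [c3 _ _] := coef_phi_roots.
have E : remP f g = c ^+ 2 *: ((w0 + w1 + w2)%:P * 'X^2
  - (w0 * (t1 + t2) + w1 * (t0 + t2) + w2 * (t0 + t1))%:P * 'X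
  + (w0 * (t1 * t2) + w1 * (t0 * t2) + w2 * (t0 * t1))%:P).
  rewrite /remP c3 (modp_derivM_roots (psi f g) c0 t01 t02 t12 phiE).
  by rewrite -/w0 -/w1 -/w2 -!mul_polyC; congr (_ * _); ring.
rewrite /p2 /p1 /p0 E !coefZ !(coefB, coefD, coefCM, coefXn, coefX, coefC) /=.
split; ring.
Qed.

(** The factor multiplying [c ^+ 6] is the determinant of the quadratic form
[sum_i w_i (u + v t_i)^2] in [u, v]. *)
Lemma Phi30_A1_roots : Phi30 f g * A1 f g = c ^+ 6 *
  (w0 * w1 * (t0 - t1) ^+ 2 + w0 * w2 * (t0 - t2) ^+ 2
   + w1 * w2 * (t1 - t2) ^+ 2).
Proof.
have [c3 c2 c1] := coef_phi_roots; have [e2 e1 e0] := coef_remP_roots.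
by rewrite /A1 det_mx33 !mxE /= c3 c2 c1 e2 e1 e0; ring.
Qed.

End ThreeRoots.

(** * Pencils of diagonal forms *)

Lemma mem_span2 (V : vectType R) (u v w : V) :
  w \in <<[:: u; v]>>%VS -> exists k l, w = k *: u + l *: v.
Proof.
rewrite span_cons span_seq1 => /memv_addP[_ /vlineP[k ->] [_ /vlineP[l ->] ->]].
by exists k, l.
Qed.

Lemma comp_linear_forms M i : 'X_i \mPo linear_forms M = linform (row i M).
Proof.
rewrite comp_mpolyXU -tnth_nth tnth_mktuple /linform.
by apply: eq_bigr => j _; rewrite mxE.
Qed.

(** In the coordinates given by the rows of [M], every form of [L] is diagonal
and its coefficients lie in the plane orthogonal to [e]. *)
Definition diagonalized (e : 'I_3 -> R) M (L : {vspace qform R}) : Prop :=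
  forall q, q \in L -> exists2 d : 'rV[R]_3,
    \sum_i e i * d 0 i = 0 & q = diag_form M d :> {mpoly R[3]}.

Lemma orbit_I_diagonalized (L : {vspace qform R}) : orbit_I L ->
  exists2 M, M \in unitmx & diagonalized (fun _ => 1) M L.
Proof.
case=> M Mu ->; exists M => // q.
rewrite limg_span /= => /mem_span2[k [l ->]]; rewrite !lfunE.
exists (\row_i [:: k + l; - k; - l]`_i).
  by rewrite sum_ord3 !mxE /=; ring.
rewrite /= !(rmorphB, rmorphXn) /= !comp_linear_forms.
by rewrite /diag_form sum_ord3 !mxE /= -!mul_mpolyC; ring.
Qed.

Lemma linform_rowD (r s : 'rV[R]_3) : linform (r + s) = linform r + linform s.
Proof.
by rewrite /linform -big_split; apply: eq_bigr => j _; rewrite !mxE scalerDl.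
Qed.

Lemma linform_rowB (r s : 'rV[R]_3) : linform (r - s) = linform r - linform s.
Proof. by apply/eqP; rewrite eq_sym subr_eq -linform_rowD subrK. Qed.

(** From [4 x z = (x + z)^2 - (x - z)^2] and
[2 (x^2 + z^2) = (x + z)^2 + (x - z)^2]. *)
Lemma orbit_Ia_diagonalized (L : {vspace qform R}) : orbit_Ia L ->
  exists2 M, M \in unitmx &
    diagonalized (fun i => if i == i1 then - 1 else 1) M L.
Proof.
case=> M Mu ->.
pose N : 'M[R]_3 := \matrix_(i < 3)
  [:: row i0 M + row i2 M; row i1 M; row i0 M - row i2 M]`_i.
have detN : \det N = - 2 * \det M by rewrite !det_mx33 !mxE /=; ring.
exists N.
  rewrite unitmxE detN unitfE mulf_neq0 -?unitfE -?unitmxE //.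
  by rewrite unitfE oppr_eq0 pnatr_eq0.
move=> q; rewrite limg_span /= => /mem_span2[k [l ->]]; rewrite !lfunE.
(* Rescaled so that no division occurs in the polynomial identity below. *)
pose k' := k / 2; pose l' := l / 4.
have [-> ->] : k = 2 * k' /\ l = 4 * l' by rewrite /k' /l'; split; field.
exists (\row_i [:: k' + l'; 2 * k'; k' - l']`_i).
  by rewrite sum_ord3 !mxE /=; ring.
rewrite /= !(rmorphD, rmorphM) /= !comp_linear_forms.
rewrite /diag_form sum_ord3 !rowK !mxE /= linform_rowD linform_rowB.
by rewrite -!mul_mpolyC; ring.
Qed.

Lemma third_ratio_eq (u0 u1 u2 t t2 : R) :
  u2 != 0 -> u0 + u1 + u2 = 0 -> u0 * t + u1 * t + u2 * t2 = 0 -> t2 = t.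
Proof.
move=> u2_neq0 u_sum ut_sum; apply: (mulfI u2_neq0).
have -> : u2 = - (u0 + u1) by lra.
by move: ut_sum; rewrite (_ : u2 = - (u0 + u1)) //; lra.
Qed.

Lemma mulr_balanced_lt0 (e0 e1 d0 d1 K : R) :
  e0 != 0 -> d0 != 0 -> 0 < K -> e0 * d0 + e1 * d1 = 0 ->
  e0 * e1 * (K * (d0 * d1)) < 0.
Proof.
move=> e0_neq0 d0_neq0 K_gt0 e_orth.
have -> : e0 * e1 * (K * (d0 * d1)) = - (K * (e0 * d0) ^+ 2).
  have -> : e0 * e1 * (K * (d0 * d1)) = K * (e0 * d0) * (e1 * d1) by ring.
  by rewrite (_ : e1 * d1 = - (e0 * d0)); [ring|lra].
by rewrite oppr_lt0 mulr_gt0 // exprn_even_gt0 //= mulf_neq0.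
Qed.

(** The roots are [t_i = - b_i / a_i]. Orthogonality to [e] has two effects: it
spreads an equality of two roots to all three, making [f] and [g]
proportional, and it ties together the two nonzero coefficients of the
degenerate form [t_i f + g], which gives the sign of [psi] there. *)
Lemma diag_forms_roots (e : 'I_3 -> R) M f g (a b : 'rV[R]_3) :
  (forall i, e i != 0) -> M \in unitmx ->
  \sum_i e i * a 0 i = 0 -> \sum_i e i * b 0 i = 0 ->
  f = diag_form M a :> {mpoly R[3]} -> g = diag_form M b :> {mpoly R[3]} ->
  qnondegenerate f -> is_pencil <<[:: f; g]>>%VS ->
  exists c t0 t1 t2,
    [/\ phi f g = c *: (('X - t0%:P) * ('X - t1%:P) * ('X - t2%:P)),
        c != 0, [/\ t0 != t1, t0 != t2 & t1 != t2]
      & [/\ e i1 * e i2 * (psi f g).[t0] < 0,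
            e i0 * e i2 * (psi f g).[t1] < 0
          & e i0 * e i1 * (psi f g).[t2] < 0]].
Proof.
move=> e0 Mu; rewrite !sum_ord3 /= => ea eb fE gE f_nondeg fg_pencil.
have fM : qmatrix f = congr_diag M a by rewrite fE qmatrix_diag_form.
have gM : qmatrix g = congr_diag M b by rewrite gE qmatrix_diag_form.
have a0 i : a 0 i != 0.
  move: f_nondeg; rewrite /qnondegenerate fM det_congr_diag !mulf_eq0 !negb_or.
  by case/andP => _ /andP[/andP[]]; elim/ord3P: i.
pose t i := - (b 0 i / a 0 i).
have bE i : b 0 i = - (t i * a 0 i) by rewrite /t mulNr opprK divfK.
exists (\det M ^+ 2 * (a 0 i0 * a 0 i1 * a 0 i2)), (t i0), (t i1), (t i2).
have not_prop s : ~ (forall i, t i = s).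
  move=> ts; have gf : g = (- s) *: f.
    apply: val_inj; rewrite /= gE fE /diag_form scaler_sumr.
    by apply: eq_bigr => i _; rewrite scalerA bE ts mulNr.
  have : (\dim <<[:: f; g]>>%VS <= 1)%N.
    rewrite span_cons span_seq1 gf.
    have /addv_idPl -> : (<[- s *: f]> <= <[f]>)%VS.
      by rewrite -memvE memvZ // memv_line.
    by rewrite dim_vline leq_b1.
  by rewrite fg_pencil.
have tneq (i j k : 'I_3) :
    e i * a 0 i + e j * a 0 j + e k * a 0 k = 0 ->
    e i * b 0 i + e j * b 0 j + e k * b 0 k = 0 ->
    (forall l, [|| l == i, l == j | l == k]) -> t i != t j.
  move=> eai ebi ijk; apply/eqP => tij; apply: (not_prop (t i)) => l.
  have tki : t k = t i.
    apply: (third_ratio_eq (mulf_neq0 (e0 k) (a0 k)) eai).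
    by move: ebi; rewrite !bE -tij; lra.
  by case/or3P: (ijk l) => /eqP ->.
have [K12 K02 K01] := minors_normsq_gt0 Mu.
have t01 : t i0 != t i1 by apply: (@tneq i0 i1 i2) => //; elim/ord3P.
have t02 : t i0 != t i2.
  by apply: (@tneq i0 i2 i1) => //; [lra | lra | elim/ord3P].
have t12 : t i1 != t i2.
  by apply: (@tneq i1 i2 i0) => //; [lra | lra | elim/ord3P].
split=> //.
- rewrite (phi_diag fM gM) !bE -!mul_polyC; ring.
- by rewrite unitmxE unitfE in Mu; rewrite !mulf_neq0.
have dE i j : t i * a 0 j + b 0 j = (t i - t j) * a 0 j by rewrite bE; ring.
have d0 i : t i * a 0 i + b 0 i = 0 by rewrite dE subrr mul0r.
have dn i j : t i != t j -> t i * a 0 j + b 0 j != 0.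
  by move=> tij; rewrite dE mulf_neq0 // subr_eq0.
have de i : e i0 * (t i * a 0 i0 + b 0 i0) + e i1 * (t i * a 0 i1 + b 0 i1)
     + e i2 * (t i * a 0 i2 + b 0 i2) = 0.
  transitivity (t i * (e i0 * a 0 i0 + e i1 * a 0 i1 + e i2 * a 0 i2) +
    (e i0 * b 0 i0 + e i1 * b 0 i1 + e i2 * b 0 i2)); first by ring.
  by rewrite ea eb mulr0 addr0.
split; rewrite (horner_psi_diag fM gM).
- have := de i0; rewrite d0 !(mul0r, mulr0, add0r, addr0) => E.
  by apply: mulr_balanced_lt0 => //; apply: dn.
- have := de i1; rewrite d0 !(mul0r, mulr0, add0r, addr0) => E.
  by apply: mulr_balanced_lt0 => //; apply: dn; rewrite eq_sym.
- have := de i2; rewrite d0 !(mul0r, mulr0, add0r, addr0) => E.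
  by apply: mulr_balanced_lt0 => //; apply: dn; rewrite eq_sym.
Qed.

End Forms.

(** * Signs of the coefficients *)

Lemma weights_neg_sign (R : realFieldType) (t0 t1 t2 w0 w1 w2 : R) :
  t0 != t1 -> w0 < 0 -> w1 < 0 -> w2 < 0 ->
  w0 + w1 + w2 < 0 /\
  0 < w0 * w1 * (t0 - t1) ^+ 2 + w0 * w2 * (t0 - t2) ^+ 2
      + w1 * w2 * (t1 - t2) ^+ 2.
Proof.
move=> t01 h0 h1 h2; split; first lra.
have sq01 : 0 < (t0 - t1) ^+ 2 by rewrite exprn_even_gt0 //= subr_eq0.
have [p01 p02 p12] : [/\ 0 < w0 * w1, 0 < w0 * w2 & 0 < w1 * w2].
  by rewrite !nmulr_rgt0.
rewrite -addrA ltr_pwDl ?(mulr_gt0 p01) //.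
by rewrite addr_ge0 // mulr_ge0 ?sqr_ge0 // ltW.
Qed.

(** The form [H(u, v) = sum_i w_i (u + v t_i)^2] with determinant [h] satisfies
[s H(u, v) = (s u + q v)^2 + h v^2] with [q = sum_i w_i t_i]. Taking
[(u, v) = (- t1, 1)] removes the weight [w1], of unknown sign, from [H(u, v)]. *)
Lemma weights_mixed_sign (R : realFieldType) (t0 t1 t2 w0 w1 w2 : R) :
  t0 != t1 -> 0 < w0 -> 0 < w2 ->
  let s := w0 + w1 + w2 in
  let h := w0 * w1 * (t0 - t1) ^+ 2 + w0 * w2 * (t0 - t2) ^+ 2
           + w1 * w2 * (t1 - t2) ^+ 2 in
  [\/ 0 < s, h < 0 | s = 0 /\ h = 0].
Proof.
move=> t01 h0 h2 s h.
have H : s * (w0 * (t0 - t1) ^+ 2 + w2 * (t2 - t1) ^+ 2)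
       = (w0 * (t0 - t1) + w2 * (t2 - t1)) ^+ 2 + h by rewrite /s /h; ring.
have pos : 0 < w0 * (t0 - t1) ^+ 2 + w2 * (t2 - t1) ^+ 2.
  apply: ltr_pwDl; last by rewrite mulr_ge0 ?sqr_ge0 // ltW.
  by rewrite mulr_gt0 // ?exprn_even_gt0 //= ?subr_eq0.
have sq := sqr_ge0 (w0 * (t0 - t1) + w2 * (t2 - t1)).
case: (ltgtP s 0) => [s0|s0|s0]; [|exact: Or31|].
  by apply: Or32; move: pos; rewrite -(nmulr_rlt0 _ s0) H; lra.
case: (ltgtP h 0) => [hn|hp|h00]; [exact: Or32| |exact: Or33].
by move: H; rewrite s0 mul0r; lra.
Qed.


Theorem proposition4 (R : realType) (f g : qform R)
    (f_nondeg : qnondegenerate f) (g_nondeg : qnondegenerate g)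
    (fg_pencil : is_pencil <<[:: f; g]>>%VS)
    (fg_orbit : orbit_I <<[:: f; g]>>%VS \/ orbit_Ia <<[:: f; g]>>%VS) :
  (orbit_I <<[:: f; g]>>%VS ->
     p2 f g < 0 /\ 0 < Phi30 f g * A1 f g) /\
  (orbit_Ia <<[:: f; g]>>%VS ->
     [\/ 0 < p2 f g, Phi30 f g * A1 f g < 0 | p2 f g = 0 /\ A1 f g = 0]).
Proof.
have fL : f \in <<[:: f; g]>>%VS by rewrite memv_span // !inE eqxx.
have gL : g \in <<[:: f; g]>>%VS by rewrite memv_span // !inE eqxx orbT.
split.
- case/orbit_I_diagonalized => M Mu diagL.
  have [[a ea fE] [b eb gE]] := (diagL f fL, diagL g gL).
  have [|c [t0 [t1 [t2 [phiE c0 [t01 t02 t12] []]]]]] :=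
    diag_forms_roots _ Mu ea eb fE gE f_nondeg fg_pencil.
    by move=> _; rewrite oner_eq0.
  rewrite !mul1r => w0 w1 w2.
  have [neg pos] := weights_neg_sign t2 t01 w0 w1 w2.
  have [-> _ _] := coef_remP_roots c0 t01 t02 t12 phiE.
  rewrite (Phi30_A1_roots c0 t01 t02 t12 phiE).
  have sgc : 0 < c ^+ 2 by rewrite exprn_even_gt0.
  by rewrite pmulr_rlt0 // pmulr_rgt0 // exprn_even_gt0.
- case/orbit_Ia_diagonalized => M Mu diagL.
  have [[a ea fE] [b eb gE]] := (diagL f fL, diagL g gL).
  have [|c [t0 [t1 [t2 [phiE c0 [t01 t02 t12] []]]]]] :=
    diag_forms_roots _ Mu ea eb fE gE f_nondeg fg_pencil.
    by move=> i; case: ifP => _; rewrite ?oppr_eq0 oner_eq0.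
  rewrite /= !(mul1r, mulr1, mulN1r) !oppr_lt0 => w0 _ w2.
  have [c3 _ _] := coef_phi_roots phiE.
  have A1E := Phi30_A1_roots c0 t01 t02 t12 phiE.
  have [p2E _ _] := coef_remP_roots c0 t01 t02 t12 phiE.
  have sgc : 0 < c ^+ 2 by rewrite exprn_even_gt0.
  have sgc6 : 0 < c ^+ 6 by rewrite exprn_even_gt0.
  have := weights_mixed_sign t2 (psi f g).[t1] t01 w0 w2.
  case=> [pos|neg|[s0 h0]].
  + by apply: Or31; rewrite p2E pmulr_rgt0.
  + by apply: Or32; rewrite A1E pmulr_rlt0.
  + apply: Or33; rewrite p2E s0 mulr0; split=> //.
    by move/eqP: A1E; rewrite h0 mulr0 c3 mulf_eq0 (negPf c0) => /eqP.
Qed.
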